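(* Let $G$ be a finite abelian group and let $k,t,\lambda$ be positive integers with $k\ge 2$ and $\lambda|G|\equiv 0\pmod{k-1}$. If there exists a $(G,k,kt\lambda)$-SDF, then there exists a $(G\times \mathbb{F}_q^+,G\times \{0\},k,\lambda)$-FDF in each of the following cases: (i) $\lambda$ is even and $q$ is any prime power with $q\equiv 1 \pmod{kt}$ and $q>Q(kt,k)$; (ii) $\lambda$ is odd and $q$ is any prime power with $q\equiv krt+1 \pmod{2krt}$ and $q>Q(krt,k)$, where $r$ is any positive integer.
   Context: Unions of (multi)sets are multiset unions, and $\underline{h}A$ denotes the multiset union of $h$ copies of $A$. $\mathbb{F}_q^+$ is the additive group of the finite field $\mathbb{F}_q$. For positive integers $d,m$, $$Q(d,m)=\tfrac14\left(U+\sqrt{U^2+4d^{m-1}m}\right)^2,\qquad U=\sum_{h=1}^m \binom{m}{h}(d-1)^h(h-1).$$ Strong difference family: let $(G,+)$ be a group and $\mathfrak{S}=[F_1,\dots,F_s]$ a family of multisets $F_i=(f_{i,0},\dots,f_{i,k-1})$ of size $k$ with entries in $G$. $\mathfrak{S}$ is a $(G,k,\mu)$-SDF if the multiset $\bigcup_{i=1}^s[f_{i,a}-f_{i,b}:0\le a,b\le k-1,\ a\ne b]$ equals $\underline{\mu}G$, i.e. every element of $G$ ($0$ included) appears exactly $\mu$ times. Frame difference family: let $H$ be a finite abelian group with a subgroup $N$ of order $n$. An $(H,N,k,\lambda)$-DF (relative difference family) is a family $\mathfrak{B}=[B_1,\dots,B_r]$ of $k$-subsets of $H$ (base blocks) such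 that the multiset $\bigcup_{i=1}^r[x-y:x,y\in B_i,\ x\neq y]$ equals $\underline{\lambda}(H\setminus N)$. It is an $(H,N,k,\lambda)$-FDF if it can be partitioned into $\lambda n/(k-1)$ subfamilies, each consisting of $(|H|-n)/(nk)$ base blocks, such that the union of the base blocks in each subfamily is a system of representatives for the nontrivial cosets of $N$ in $H$. *)

(* Defs.v *)
From HB Require Import structures.
From mathcomp Require Import all_boot all_order all_algebra.
Set Implicit Arguments.
Unset Strict Implicit.
Unset Printing Implicit Defensive.
Import Order.TTheory GRing.Theory Num.Theory.
Local Open Scope ring_scope.

(* The finZmodType structure on products of finZmodTypes is not declared in
   MathComp: this joins the existing finType and zmodType structures. *)
HB.saturate prod.

(* Multisets are represented by sequences up to [perm_eq], and multiset union
   by concatenation. *)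

Definition copies (T : finType) (h : nat) (A : {set T}) : seq T :=
  flatten (nseq h (enum A)).

(* The entries of a member of an SDF are indexed (and may repeat), so that the
   differences are taken over pairs of distinct indices. *)
Definition sdf_diffs (G : zmodType) (k : nat) (f : k.-tuple G) : seq G :=
  [seq tnth f a - tnth f b | a <- enum 'I_k, b <- enum (predC1 a)].

Definition is_SDF (G : finZmodType) (k mu : nat) (S : seq (k.-tuple G)) : Prop :=
  perm_eq (flatten (map (@sdf_diffs G k) S)) (copies mu [set: G]).

Definition block_diffs (H : finZmodType) (B : {set H}) : seq H :=
  [seq x - y | x <- enum B, y <- enum (B :\ x)].

Definition is_DF (H : finZmodType) (N : {set H}) (k lambda : nat)
    (BB : seq {set H}) : Prop :=
  [/\ GRing.zmod_closed N,
      all (fun B : {set H} => #|B| == k) BB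
    & perm_eq (flatten (map (@block_diffs H) BB)) (copies lambda (~: N))].

Definition add_coset (H : finZmodType) (N : {set H}) (x : H) : {set H} :=
  [set x + y | y in N].

Definition nontrivial_cosets (H : finZmodType) (N : {set H}) : {set {set H}} :=
  [set add_coset N x | x in ~: N].

(* The multiset [s] contains exactly one element, counted with multiplicity, of
   each nontrivial coset of [N], and no other element. *)
Definition nontrivial_coset_reps (H : finZmodType) (N : {set H}) (s : seq H) :
    Prop :=
  perm_eq (map (add_coset N) s) (enum (nontrivial_cosets N)).

(* With n = #|N|, the numbers lambda n / (k - 1) of subfamilies and
   (|H| - n) / (n k) of blocks in each of them are required to be exact
   quotients, hence the multiplicative form. *)
Definition is_FDF (H : finZmodType) (N : {set H}) (k lambda : nat)
    (BB : seq {set H}) : Prop :=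
  is_DF N k lambda BB /\
  exists P : seq (seq {set H}),
    [/\ perm_eq (flatten P) BB,
        (size P * k.-1 = lambda * #|N|)%N
      & forall C : seq {set H}, C \in P ->
          (size C * (#|N| * k) = #|H| - #|N|)%N /\
          nontrivial_coset_reps N (flatten [seq enum B | B : {set H} <- C])].

Section Bound.

Variable R : rcfType.

Definition Ubound (d m : nat) : R :=
  \sum_(1 <= h < m.+1) 'C(m, h)%:R * (d%:R - 1) ^+ h * (h%:R - 1).

Definition Qbound (d m : nat) : R :=
  4^-1 * (Ubound d m +
          Num.sqrt (Ubound d m ^+ 2 + 4 * d%:R ^+ (m.-1) * m%:R)) ^+ 2.

End Bound.

(* Main.v *)
Require Import Defs.
From HB Require Import structures.
From mathcomp Require Import all_boot all_order all_algebra.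
From mathcomp Require Import cyclic finfield.
From mathcomp Require Import ring lra zify.
Set Implicit Arguments.
Unset Strict Implicit.
Unset Printing Implicit Defensive.
Import Order.TTheory GRing.Theory Num.Theory.
Local Open Scope ring_scope.

(** Let the members of the strong difference family be [F_p = (f_(p,0), ..., f_(p,k-1))].
    The base blocks of the frame difference family are the sets
    [{(f_(p,j), m phi_(p,j)) : j < k}], where the elements [phi_(p,j)] of the field and the
    multipliers [m] are chosen as follows. Let d be k t, or k r t when lambda is odd, and
    write Z_d as a direct sum [TL + S], with [TL] of size k t; the multipliers are the
    nonzero elements whose discrete logarithm modulo d is in [S]. The number of members is
    a multiple M t of t. If, in each of M groups of t members, the logarithms of the
    [phi_(p,j)] are the elements of [TL], then the dilates of the blocks of a group
    represent each nontrivial coset once; if, for each g, the logarithms of the differences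
    [phi_(p,i) - phi_(p,j)] taken at the positions where [f_(p,i) - f_(p,j) = g] cover [TL]
    lambda times, then the dilates form a difference family ([dilates_FDF]). So it is
    enough to prescribe these logarithms, which are subject to the only constraint that
    exchanging i and j adds the logarithm of -1 ([balanced_coloring]), and to find elements
    of the field with prescribed logarithms and differences of prescribed logarithms
    ([exists_colored_clique]). If lambda is even, the choice [TL = Z_d], [S = 0] works; if
    lambda is odd, k t is even and the logarithm of -1 is d / 2, and [tiling_Zd] gives a
    decomposition with [TL] the union of an interval and its translate by d / 2.

    The Weil bound on multiplicative character sums would give the elements phi one after
    the other, whence the value of Q(d, k). As they can be chosen together, they can be
    seen as a clique, with 0 as an additional vertex, in a complete graph on F whose edges
    are colored by the cyclotomic classes, and the greedy embedding of a clique in a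
    pseudorandom graph works. Pseudorandomness means here that, for each
    class C and each large set V, the number of u in V such that v - u is in C is close to
    |V| / d for most v ([cyc_conv_bound]). Its proof is a computation of a second moment,
    summed over the classes ([second_moment]), in which no character appears. A sharper
    form for the first vertex ([cyc_number_ge]), as strong as the bound on Jacobi sums,
    makes the condition q > Q(d, k) sufficient for all k >= 2 and d >= 2
    ([clique_bound_le]). *)

(** * Finite sums, lists and counting *)

Lemma sqr_sum_le (R : realFieldType) (I : finType) (P : pred I) (h : I -> R) :
  (\sum_(i | P i) h i) ^+ 2 <= #|P|%:R * \sum_(i | P i) h i ^+ 2.
Proof.
have : 0 <= \sum_(i | P i) \sum_(j | P j) (h i - h j) ^+ 2.
  by apply: sumr_ge0 => i _; apply: sumr_ge0 => j _; exact: sqr_ge0.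
have -> : \sum_(i | P i) \sum_(j | P j) (h i - h j) ^+ 2 =
  2 * (#|P|%:R * (\sum_(i | P i) h i ^+ 2) - (\sum_(i | P i) h i) ^+ 2).
  transitivity (\sum_(i | P i) (#|P|%:R * h i ^+ 2 - 2 * h i * (\sum_(j | P j) h j)
      + \sum_(j | P j) h j ^+ 2)).
    apply: eq_bigr => i _; rewrite mulr_sumr.
    have -> : #|P|%:R * h i ^+ 2 = \sum_(j | P j) h i ^+ 2.
      by rewrite sumr_const mulr_natl.
    by rewrite -sumrB -big_split /=; apply: eq_bigr => j _; ring.
  rewrite big_split sumrB /= [X in _ + X]sumr_const -mulr_suml -!mulr_sumr -mulr_natl; ring.
by rewrite pmulr_rge0 ?ltr0n // subr_ge0.
Qed.

Lemma sum_indic {R : realFieldType} (T : finType) (P : pred T) :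
  \sum_x (P x)%:R = #|P|%:R :> R.
Proof.
rewrite -sum1_card natr_sum [RHS]big_mkcond /=; apply: eq_bigr => x _.
by rewrite unfold_in; case: (P x).
Qed.

Lemma sum_mem {R : realFieldType} (T : finType) (A : {set T}) :
  \sum_x (x \in A)%:R = #|A|%:R :> R.
Proof. exact: sum_indic. Qed.

Lemma card_take_enum (T : finType) (A : {set T}) n : (n <= #|A|)%N ->
  #|[set x in take n (enum A)]| = n.
Proof.
by move=> nA; rewrite cardsE (card_uniqP _) ?take_uniq ?enum_uniq // size_takel // -cardE.
Qed.

Lemma card_Zd d : (1 < d)%N -> #|{: 'Z_d}| = d.
Proof. by move=> d_gt1; rewrite card_ord Zp_cast. Qed.

Lemma map_nth_index (I : eqType) (T : Type) (x0 : T) (e : seq I) (s : seq T) :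
  uniq e -> size e = size s -> [seq nth x0 s (index i e) | i <- e] = s.
Proof.
case: e => [|i0 e]; first by case: s.
move=> ue es; apply: (@eq_from_nth _ x0); rewrite size_map // => i ie.
by rewrite (nth_map i0) // index_uniq.
Qed.

(** A list of length #|I| is the list of values of a function on I. *)
Lemma seq_as_family (I : finType) (T : Type) (s : seq T) : #|I| = size s ->
  exists f : I -> T, s = [seq f i | i <- enum I].
Proof.
case: s => [|x0 s] cI.
  have no (i : I) : False by have := cI; rewrite (cardD1 i) inE.
  exists (fun i => match no i with end).
  by apply/esym/size0nil; rewrite size_map -cardE cI.
exists (fun i => nth x0 (x0 :: s) (index i (enum I))).
by rewrite map_nth_index ?enum_uniq // -cardE.
Qed.

Lemma count_sum (T : Type) (P : pred T) (s : seq T) :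
  count P s = (\sum_(x <- s) P x)%N.
Proof. by rewrite -sum1_count big_mkcond; apply: eq_bigr => x _; case: (P x). Qed.

Lemma count_mem_perm (T : eqType) (s1 s2 : seq T) :
  (forall x, count_mem x s1 = count_mem x s2) -> perm_eq s1 s2.
Proof. by move=> e; apply/allP => x _; apply/eqP/e. Qed.

Lemma count_nseq_flatten (T : Type) (P : pred T) n (s : seq T) :
  count P (flatten (nseq n s)) = (n * count P s)%N.
Proof. by rewrite count_flatten map_nseq sumn_nseq mulnC. Qed.

Lemma count_copies (T : finType) n (A : {set T}) x :
  count_mem x (copies n A) = (n * (x \in A))%N.
Proof. by rewrite count_nseq_flatten count_uniq_mem ?enum_uniq // mem_enum. Qed.

Lemma count_eq1 (T : eqType) (s : seq T) (P : pred T) m : uniq s -> m \in s ->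
  {in s, forall c, P c = (c == m)} -> count P s = 1%N.
Proof. by move=> us ms e; rewrite (eq_in_count e) count_uniq_mem // ms. Qed.

(** * Cyclotomic classes and their second moments *)

Section Cyclotomy.
Variables (F : finFieldType) (d : nat) (cl : F -> 'Z_d).
Hypothesis d_gt1 : (1 < d)%N.
(* cl is a discrete logarithm modulo d; its value at 0 is irrelevant. *)
Hypothesis clM : forall x y, x != 0 -> y != 0 -> cl (x * y) = cl x + cl y.
Hypothesis cl_onto : forall c, exists2 x, x != 0 & cl x = c.

(** The cyclotomic class of index c: the nonzero elements of logarithm c. *)
Definition cyc (c : 'Z_d) : {set F} := [set x | (x != 0) && (cl x == c)].

Lemma cl1 : cl 1 = 0.
Proof.
by apply: (@addrI _ (cl 1)); rewrite addr0 -clM ?oner_neq0 // mulr1.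
Qed.

Lemma clV x : x != 0 -> cl x^-1 = - cl x.
Proof.
move=> nz; apply: (@addrI _ (cl x)).
by rewrite -clM ?invr_neq0 // mulfV // cl1 subrr.
Qed.

Lemma cl_div x y : x != 0 -> y != 0 -> cl (x / y) = cl x - cl y.
Proof. by move=> nx ny; rewrite clM ?invr_neq0 // clV. Qed.

Lemma cyc_scale c y z : y != 0 -> (y * z \in cyc c) = (z \in cyc (c - cl y)).
Proof.
move=> ny; rewrite !inE mulf_eq0 negb_or ny /=.
by case: eqVneq => //= nz; rewrite clM // [RHS]eq_sym subr_eq [RHS]eq_sym addrC.
Qed.

Lemma card_cyc0 c : #|cyc c| = #|cyc 0|.
Proof.
have [w nw wc] := cl_onto c.
rewrite -(card_imset (mem (cyc 0)) (mulfI nw)); apply: eq_card => z.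
apply/idP/imsetP => [zc|[y y0 ->]]; last by rewrite cyc_scale // wc subrr.
exists (w^-1 * z); last by rewrite mulrA mulfV // mul1r.
by rewrite cyc_scale ?invr_neq0 // clV // opprK add0r wc.
Qed.

Lemma card_cyc c : (#|cyc c| * d = #|F|.-1)%N.
Proof.
rewrite card_cyc0 -(cardC1 (0 : F)) -[in RHS]sum1_card (partition_big cl predT) //=.
under [RHS]eq_bigr => c0 _.
  rewrite (eq_bigl (mem (cyc c0))); last by move=> x; rewrite !inE.
  rewrite sum1_card card_cyc0; over.
by rewrite sum_nat_const card_Zd // mulnC.
Qed.

Variable R : realFieldType.
Local Notation q := (#|F|%:R : R).
Local Notation D := (d%:R : R).

(** The balanced indicator of a class: d times the indicator of the class minus the
    indicator of F^*. It has sum 0, and the sum over all the classes vanishes too. *)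
Definition cycK (c : 'Z_d) (z : F) : R := D * (z \in cyc c)%:R - (z != 0)%:R.

(** The convolution of cycK c with g. *)
Definition cyc_conv (c : 'Z_d) (g : F -> R) (v : F) : R :=
  \sum_u cycK c (v - u) * g u.

Lemma D_gt1 : 1 < D. Proof. by rewrite ltr1n. Qed.

Lemma sum_Zd_delta (a : 'Z_d) (h : 'Z_d -> R) : \sum_c (a == c)%:R * h c = h a.
Proof.
rewrite (bigD1 a) //= eqxx mul1r big1 ?addr0 // => c ca.
by rewrite eq_sym (negbTE ca) mul0r.
Qed.

Lemma card_predF : (#|F|.-1)%:R = q - 1 :> R.
Proof. by rewrite -subn1 natrB //; apply/card_gt0P; exists 0. Qed.

Lemma card_cycR c : #|cyc c|%:R * D = q - 1.
Proof. by rewrite -natrM card_cyc card_predF. Qed.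

Lemma cycKE c z : cycK c z = (z != 0)%:R * (D * (cl z == c)%:R - 1).
Proof. by rewrite /cycK inE; case: (z != 0); rewrite /= ?mul1r ?mul0r ?mulr0 ?subr0. Qed.

Lemma sum_const_Zd (a : R) : \sum_(c : 'Z_d) a = D * a.
Proof. by rewrite sumr_const card_Zd // mulr_natl. Qed.

(** The balanced indicators of all the classes add up to 0 at each point. *)
Lemma sum_cycK z : \sum_c cycK c z = 0.
Proof.
under eq_bigr do rewrite cycKE.
rewrite -mulr_sumr sumrB sum_const_Zd -mulr_sumr.
under eq_bigr do rewrite -[_%:R]mulr1.
by rewrite sum_Zd_delta subrr mulr0.
Qed.

Lemma sum_cycK2 z w : \sum_c cycK c z * cycK c w =
  (z != 0)%:R * (w != 0)%:R * (D ^+ 2 * (cl z == cl w)%:R - D).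
Proof.
under eq_bigr do rewrite !cycKE mulrACA.
rewrite -mulr_sumr; congr (_ * _).
transitivity (\sum_c ((cl z == c)%:R * (D ^+ 2 * (cl w == c)%:R - D)
   - ((cl w == c)%:R * D) + 1)).
  by apply: eq_bigr => c _; ring.
by rewrite big_split sumrB /= !sum_Zd_delta sum_const_Zd mulr1 subrK eq_sym.
Qed.

(** For u <> u', the map v |-> (v - u) / (v - u') is a bijection from F minus {u, u'} to
    F minus {0, 1}, so that v - u and v - u' are in the same class for exactly
    (q - 1) / d - 1 elements v. *)
Lemma cycK_corr u u' : \sum_v \sum_c cycK c (v - u) * cycK c (v - u') =
  D * (D - 1) * (q * (u == u')%:R - 1).
Proof.
under eq_bigr do rewrite sum_cycK2.
have D0 : D != 0 by rewrite pnatr_eq0 -lt0n ltnW.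
have [<-|uu'] := eqVneq u u'; rewrite ?mulr1.
  under eq_bigr do rewrite eqxx mulr1 -natrM mulnb andbb subr_eq0.
  by rewrite -mulr_suml sum_indic cardC1 card_predF; ring.
pose r v := (v - u) / (v - u').
have uB : u - u' != 0 by rewrite subr_eq0.
transitivity (\sum_(v | (v != u) && (v != u')) (D ^+ 2 * (cl (r v) == 0)%:R - D)).
  rewrite [RHS]big_mkcond /=; apply: eq_bigr => v _.
  rewrite -!(subr_eq0 v) /r; case: eqVneq => [|n1]; rewrite ?mul0r //=.
  case: eqVneq => [|n2]; rewrite ?mulr0 ?mul0r ?mul1r //=.
  by rewrite cl_div // subr_eq0.
transitivity (\sum_(y | (y != 0) && (y != 1)) (D ^+ 2 * (cl y == 0)%:R - D)).
  rewrite [RHS](reindex_onto r (fun y => (u - y * u') / (1 - y))) /=; last first.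
    move=> y /andP[y0 y1]; rewrite /r.
    have n1 : 1 - y != 0 by rewrite subr_eq0 eq_sym.
    have -> : (u - y * u') / (1 - y) - u = y * (u - u') / (1 - y) by field.
    have -> : (u - y * u') / (1 - y) - u' = (u - u') / (1 - y) by field.
    by field; rewrite n1 uB.
  apply: eq_bigl => v; rewrite /r.
  case: (eqVneq v u') => [->|n2]; first by rewrite subrr invr0 mulr0 eqxx andbF.
  have {}n2 : v - u' != 0 by rewrite subr_eq0.
  case: (eqVneq v u) => [->|n1]; first by rewrite subrr mul0r eqxx.
  have {}n1 : v - u != 0 by rewrite subr_eq0.
  rewrite mulf_neq0 ?invr_neq0 //=.
  have e : 1 - (v - u) / (v - u') = (u - u') / (v - u') by field.
  have ne : 1 - (v - u) / (v - u') != 0 by rewrite e mulf_neq0 ?invr_neq0.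
  rewrite eq_sym -subr_eq0 ne /=; apply/esym/eqP.
  by rewrite e; field; rewrite n2 uB.
have -> : \sum_(y | (y != 0) && (y != 1)) (D ^+ 2 * (cl y == 0)%:R - D) =
    \sum_(y | y != 0) (D ^+ 2 * (cl y == 0)%:R - D) - (D ^+ 2 - D).
  rewrite [in RHS](bigD1 1) ?oner_neq0 //= cl1 eqxx mulr1; ring.
rewrite sumrB -mulr_sumr sumr_const cardC1 -[X in _ - X - _]mulr_natr card_predF ?mulr0.
have -> : \sum_(y | y != 0) (cl y == 0)%:R = #|cyc 0|%:R :> R.
  rewrite -(sum_indic (fun x => x \in cyc 0)) big_mkcond /=.
  by apply: eq_bigr => y _; rewrite inE; case: (y != 0).
by rewrite -(card_cycR 0); ring.
Qed.

(** The elementary substitute for the evaluation of Gauss sums: an exact second moment,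
    summed over all the classes. *)
Lemma second_moment g :
  \sum_c \sum_v cyc_conv c g v ^+ 2 =
  D * (D - 1) * (q * \sum_u g u ^+ 2 - (\sum_u g u) ^+ 2).
Proof.
transitivity (\sum_u \sum_u' g u * g u' *
    \sum_v \sum_c cycK c (v - u) * cycK c (v - u')).
  rewrite exchange_big /=.
  transitivity (\sum_v \sum_c \sum_u \sum_u' 
     g u * g u' * (cycK c (v - u) * cycK c (v - u'))).
    apply: eq_bigr => v _; apply: eq_bigr => c _.
    rewrite expr2 big_distrlr /=; apply: eq_bigr => u _; apply: eq_bigr => u' _; ring.
  under [RHS]eq_bigr do under eq_bigr do rewrite mulr_sumr.
  under [RHS]eq_bigr do rewrite exchange_big /=.
  rewrite [RHS]exchange_big /=; apply: eq_bigr => v _.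
  under [RHS]eq_bigr do under eq_bigr do rewrite mulr_sumr.
  under [RHS]eq_bigr do rewrite exchange_big /=.
  by rewrite [RHS]exchange_big.
under eq_bigr do under eq_bigr do rewrite cycK_corr.
transitivity (\sum_u D * (D - 1) * (q * g u ^+ 2 - g u * \sum_u' g u')).
  apply: eq_bigr => u _.
  under eq_bigr do rewrite mulrCA.
  rewrite -mulr_sumr; congr (_ * _).
  under eq_bigr do rewrite mulrBr mulr1.
  rewrite sumrB -mulr_sumr; congr (_ - _).
  rewrite (bigD1 u) //= eqxx mulr1 big1 ?addr0; first by ring.
  by move=> v vu; rewrite eq_sym (negbTE vu) !mulr0.
by rewrite -mulr_sumr sumrB -mulr_sumr -mulr_suml expr2.
Qed.

Lemma sum_cyc_conv g v : \sum_c cyc_conv c g v = 0.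
Proof.
rewrite /cyc_conv exchange_big big1 //= => u _.
by rewrite -mulr_suml sum_cycK mul0r.
Qed.

(** Since the d convolutions add up to 0 pointwise, one of them cannot carry the whole
    second moment; Cauchy-Schwarz on the d - 1 others gives the factor (d - 1)^2, which
    is the one that the bound sqrt q on Gauss sums would give. *)
Lemma cyc_conv_bound c g : \sum_v cyc_conv c g v ^+ 2 <=
  (D - 1) ^+ 2 * (q * (\sum_u g u ^+ 2) - (\sum_u g u) ^+ 2).
Proof.
have D1 := D_gt1; have D0 : 0 < D by lra.
have le v : cyc_conv c g v ^+ 2 <= (D - 1) * \sum_(c' | c' != c) cyc_conv c' g v ^+ 2.
  have /eqP := sum_cyc_conv g v; rewrite (bigD1 c) //= addr_eq0 => /eqP ->.
  rewrite sqrrN (le_trans (sqr_sum_le _ _)) // cardC1 card_Zd //.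
  by rewrite -subn1 natrB // ltnW.
have := second_moment g; rewrite (bigD1 c) //= => e.
have : \sum_v cyc_conv c g v ^+ 2 <=
   (D - 1) * \sum_(c' | c' != c) \sum_v cyc_conv c' g v ^+ 2.
  rewrite exchange_big mulr_sumr; exact: ler_sum.
move: e; set A := \sum_v cyc_conv c g v ^+ 2.
set B := \sum_(c' | c' != c) _; set X := q * _ - _ => e AB.
suff : D * A <= D * ((D - 1) ^+ 2 * X) by rewrite ler_pM2l.
have -> : D * ((D - 1) ^+ 2 * X) = (D - 1) * (A + B) by rewrite e; ring.
by rewrite mulrDr; lra.
Qed.

Lemma sum_cycKv c : \sum_z cycK c z = 0.
Proof.
under eq_bigr do rewrite /cycK.
rewrite sumrB -mulr_sumr sum_mem.
by rewrite (sum_indic (fun z : F => z != 0)) cardC1 card_predF mulrC card_cycR subrr.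
Qed.

Lemma sum_cycK_sub c v : \sum_u cycK c (v - u) = 0.
Proof.
rewrite -[RHS](sum_cycKv c) [RHS](reindex_inj (inv_inj (subKr v))) /=.
by apply: eq_bigr => u _.
Qed.

Lemma sum_cyc_conv_v c g : \sum_v cyc_conv c g v = 0.
Proof.
rewrite /cyc_conv exchange_big big1 //= => u _; rewrite -mulr_suml.
suff -> : \sum_v cycK c (v - u) = 0 by rewrite mul0r.
rewrite -[RHS](sum_cycKv c) [RHS](reindex_inj (addIr (- u))) /=.
by apply: eq_bigr.
Qed.

Lemma cyc_conv_set c (V : {set F}) v :
  cyc_conv c (fun u => (u \in V)%:R) v =
  D * #|[set u in V | v - u \in cyc c]|%:R - #|V|%:R + (v \in V)%:R.
Proof.
rewrite /cyc_conv /cycK.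
transitivity (\sum_u (D * (u \in [set u in V | v - u \in cyc c])%:R - (u \in V)%:R
    + (v == u)%:R * (u \in V)%:R)).
  apply: eq_bigr => u _; rewrite !inE subr_eq0.
  by case: (u \in V); case: eqVneq; case: (cl _ == c) => /= *; ring.
rewrite big_split sumrB /= -mulr_sumr !sum_mem; congr (_ + _).
rewrite (bigD1 v) //= eqxx mul1r big1 ?addr0 // => u uv.
by rewrite eq_sym (negbTE uv) mul0r.
Qed.

Lemma cycK_scale c e z : e != 0 -> cl e = 0 -> cycK c (e * z) = cycK c z.
Proof.
move=> e0 ce; rewrite /cycK cyc_scale // ce subr0 mulf_eq0 negb_or e0.
by [].
Qed.

Lemma cyc_conv_class c c' x v : x != 0 -> v != 0 -> cl x = cl v ->
  cyc_conv c (cycK c') x = cyc_conv c (cycK c') v.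
Proof.
move=> x0 v0 xv; have e0 : x / v != 0 by rewrite mulf_neq0 ?invr_neq0.
have ce : cl (x / v) = 0 by rewrite cl_div // xv subrr.
rewrite {1}/cyc_conv (reindex_inj (mulfI e0)) /=; apply: eq_bigr => u _.
rewrite -{1}(divfK v0 x) -mulrBr !cycK_scale //.
Qed.

Lemma sum_cycK_sqr c : \sum_z cycK c z ^+ 2 = (q - 1) * (D - 1).
Proof.
transitivity (\sum_z ((D ^+ 2 - 2 * D) * (z \in cyc c)%:R + (z != 0)%:R)).
  apply: eq_bigr => z _; rewrite /cycK inE.
  by case: (z != 0); case: (cl z == c) => /=; ring.
rewrite big_split /= -mulr_sumr sum_mem.
rewrite (sum_indic (fun z : F => z != 0)) cardC1 card_predF -(card_cycR c); ring.
Qed.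

(** The value at 0 depends on whether the class c' is the opposite of the class c. *)
Lemma cyc_conv_K0 c c' : exists b : bool,
  cyc_conv c (cycK c') 0 = #|cyc c'|%:R * (D ^+ 2 * b%:R - D).
Proof.
exists (c' == c - cl (-1)).
have n1 : (-1 : F) != 0 by rewrite oppr_eq0 oner_neq0.
rewrite /cyc_conv.
transitivity (\sum_u (D ^+ 2 * (c' == c - cl (-1))%:R * (u \in cyc c')%:R
   - D * (u \in cyc c')%:R - D * (u \in cyc (c - cl (-1)))%:R + (u != 0)%:R)).
  apply: eq_bigr => u _; rewrite sub0r -[- u]mulN1r /cycK cyc_scale // mulf_eq0 (negbTE n1) /= !inE.
  case: (u != 0) => /=; last by ring.
  case: (eqVneq (cl u) c') => [->|]; first by case: (c' == _) => /=; ring.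
  by case: (cl u == _) => /= _; ring.
rewrite big_split !sumrB /= -!mulr_sumr !sum_mem.
rewrite (sum_indic (fun z : F => z != 0)) cardC1 card_predF.
rewrite (card_cyc0 (c - cl (-1))) -(card_cyc0 c') -(card_cycR c'); ring.
Qed.

Lemma card_cyc_gt0 c : (0 < #|cyc c|)%N.
Proof. by have [x x0 xc] := cl_onto c; apply/card_gt0P; exists x; rewrite inE x0 xc eqxx. Qed.

(* s stands for the square root of q. *)
Variable s : R.
Hypothesis s_ge2 : 2 <= s.
Hypothesis s_sqr : s ^+ 2 = q.

Lemma s_ge0 : 0 <= s. Proof. exact: le_trans s_ge2. Qed.

(** A sharp form of cyc_conv_bound when g is itself a balanced indicator: the convolution
    is then constant on each class. This has the strength of the bound sqrt q on Jacobi
    sums. *)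
Lemma cyc_conv_K_ge c c' v : v != 0 ->
  - ((D - 1) ^+ 2 * s) <= cyc_conv c (cycK c') v.
Proof.
move=> v0; pose h := cyc_conv c (cycK c').
set f : R := #|cyc c'|%:R.
have f_gt0 : 0 < f by rewrite ltr0n card_cyc_gt0.
have fD : f * D = s ^+ 2 - 1 by rewrite s_sqr card_cycR.
have D1 : 1 <= D - 1 by rewrite lerBrDr -(natrD _ 1 1) ler_nat.
pose P x := (x != 0) && (cl x != cl v).
have split_sum (g : F -> R) : (forall x, x != 0 -> cl x = cl v -> g x = g v) ->
    \sum_x g x = g 0 + f * g v + \sum_(x | P x) g x.
  move=> gv; rewrite (bigD1 0) //= -addrA; congr (_ + _).
  rewrite (bigID (fun x => cl x == cl v)) /=; congr (_ + _).
  rewrite (eq_bigl (mem (cyc (cl v)))); last by move=> x; rewrite !inE.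
  rewrite (eq_bigr (fun=> g v)); last by move=> x; rewrite !inE => /andP[x0 /eqP]; exact: gv.
  by rewrite sumr_const -mulr_natl card_cyc0 -(card_cyc0 c').
have cardP : #|P|%:R = f * (D - 1).
  have := split_sum (fun=> 1) (fun _ _ _ => erefl).
  rewrite !sumr_const (_ : #|[eta P]| = #|P|) //.
  have -> : 1 *+ #|F| = s ^+ 2 :> R by rewrite s_sqr.
  move=> e; have -> : #|P|%:R = s ^+ 2 - 1 - f :> R by rewrite e; ring.
  rewrite -fD; ring.
have hv x : x != 0 -> cl x = cl v -> h x = h v by move=> *; apply: cyc_conv_class.
have s1 := split_sum h hv; rewrite sum_cyc_conv_v in s1.
have s2 := cyc_conv_bound c (cycK c'); rewrite sum_cycKv sum_cycK_sqr in s2.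
rewrite (split_sum (fun x => h x ^+ 2)) in s2; last by move=> x x0 xv; rewrite hv.
have s3 := sqr_sum_le P h; rewrite cardP in s3.
have [b hb] := cyc_conv_K0 c c'; rewrite -/h -/f in hb.
rewrite -s_sqr hb in s2; rewrite hb in s1.
move: s1 s2 s3; rewrite -/(h v).
set w : R := _ - D; set X := \sum_(x | P x) h x; set Y := \sum_(x | P x) _ => s1 s2 s3.
have key : (D - 1) * h v ^+ 2 + (h v + w) ^+ 2 + (D - 1) * f * w ^+ 2
    <= (D - 1) ^+ 4 * s ^+ 2 * D.
  have eX : X = - (f * (h v + w)) by lra.
  have : f * (h v + w) ^+ 2 <= (D - 1) * Y.
    by rewrite -(ler_pM2l f_gt0); move: s3; rewrite eX; lra.
  have : (f * w) ^+ 2 + f * h v ^+ 2 + Y <= (D - 1) ^+ 3 * s ^+ 2 * (f * D).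
    by rewrite fD; lra.
  move=> i1 i2; rewrite -(ler_pM2l f_gt0).
  have : (D - 1) * ((f * w) ^+ 2 + f * h v ^+ 2 + Y) <=
      (D - 1) * ((D - 1) ^+ 3 * s ^+ 2 * (f * D)) by rewrite ler_wpM2l //; lra.
  lra.
rewrite leNgt; apply/negP => hA; rewrite -/h in hA.
set A := (D - 1) ^+ 2 * s in hA.
have s0 : 0 <= s by apply: le_trans s_ge2.
have A_ge0 : 0 <= A by rewrite mulr_ge0 ?sqr_ge0.
have AE : (D - 1) ^+ 4 * s ^+ 2 = A ^+ 2 by rewrite /A; ring.
have D0 : 0 < D by lra.
have hAA : A ^+ 2 < h v ^+ 2 by rewrite -[h v ^+ 2]sqrrN ltrXn2r ?nnegrE //; lra.
rewrite AE in key.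
(* The class c' is either opposite to c, or not. *)
have [wE|wE] : w = D * (D - 1) \/ w = - D.
- by rewrite /w; case: (b); [left | right]; rewrite ?mulr1 ?mulr0; ring.
- have : D * (h v ^+ 2 + 2 * h v * (D - 1) + D * (D - 1) ^+ 2 + (D - 1) ^+ 3 * (f * D)) <=
     D * A ^+ 2 by move: key; rewrite wE; lra.
  rewrite (ler_pM2l D0) fD => {}key.
  have DA : D - 1 <= A.
    rewrite /A -[leLHS]mulr1 expr2 -mulrA ler_pM2l; last lra.
    by apply: mulr_ege1; have := s_ge2; lra.
  have i1 : (A - (D - 1)) ^+ 2 < (- h v - (D - 1)) ^+ 2 by rewrite ltrXn2r ?nnegrE //; lra.
  have i2 : (D - 1) ^+ 3 * s * 2 <= (D - 1) ^+ 3 * s * s.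
    by rewrite ler_wpM2l // mulr_ge0 ?exprn_ge0 //; lra.
  have i3 : 1 <= (D - 1) ^+ 2 by rewrite exprn_ege1.
  have AD : A * (D - 1) = (D - 1) ^+ 3 * s by rewrite /A; ring.
  lra.
have : D * (h v ^+ 2 - 2 * h v + D + (D - 1) * (f * D)) <= D * A ^+ 2.
  by move: key; rewrite wE; lra.
rewrite (ler_pM2l D0) fD.
have : 0 <= (D - 1) * (s ^+ 2 - 1) by rewrite -fD !mulr_ge0 //; lra.
lra.
Qed.

(** A lower bound on cyclotomic numbers. *)
Lemma cyc_number_ge c c' v : v != 0 ->
  s ^+ 2 - 2 * D - (D - 1) ^+ 2 * s <= D ^+ 2 * #|[set u in cyc c' | v - u \in cyc c]|%:R.
Proof.
move=> v0; have lb := cyc_conv_K_ge c c' v0.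
have D1 := D_gt1.
suff e : cyc_conv c (cycK c') v = D ^+ 2 * #|[set u in cyc c' | v - u \in cyc c]|%:R
    - (q - 1) + D * (v \in cyc c')%:R + (D * (v \in cyc c)%:R - 1).
  move: lb; rewrite {}e -s_sqr.
  by case: (v \in cyc c'); case: (v \in cyc c) => /=; lra.
transitivity (D * cyc_conv c (fun u => (u \in cyc c')%:R) v + cycK c v).
  transitivity (\sum_u (D * (cycK c (v - u) * (u \in cyc c')%:R) - cycK c (v - u)
     + (u == 0)%:R * cycK c v)).
    apply: eq_bigr => u _; rewrite [cycK c' u]/cycK; case: eqVneq => [->|_] /=;
      rewrite ?subr0; ring.
  rewrite big_split sumrB /= -mulr_sumr sum_cycK_sub subr0; congr (_ + _).
  by rewrite (bigD1 0) //= eqxx mul1r big1 ?addr0 // => u /negbTE ->; rewrite mul0r.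
rewrite cyc_conv_set /cycK v0 -(card_cycR c') /=; ring.
Qed.

(** If each of m + 1 sets of field elements has more than clique_bound m elements, there is
    a clique with arbitrarily prescribed colors and one vertex in each of them. *)
Fixpoint clique_bound (m : nat) : R :=
  if m is m'.+1 then D * clique_bound m' + 1 + m%:R * (D - 1) * s else 0.

Lemma clique_bound_ge0 m : 0 <= clique_bound m.
Proof.
have D1 := D_gt1; have s0 := s_ge0.
elim: m => //= m IH; rewrite addr_ge0 ?addr_ge0 ?mulr_ge0 //; lra.
Qed.

(** The greedy embedding of a colored clique: the vertex in V 0 is chosen, by the second
    moment bound, so that each other set keeps a proportion of almost 1/d. *)
Lemma clique_in_sets m (V : nat -> {set F}) (ec : nat -> nat -> 'Z_d) :
  (forall j, (j <= m)%N -> clique_bound m < #|V j|%:R) ->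
  exists x : nat -> F, (forall j, (j <= m)%N -> x j \in V j) /\
    (forall i j, (i < j <= m)%N -> x i - x j \in cyc (ec i j)).
Proof.
have D1 := D_gt1; have D0 : 0 < D by lra.
have s0 := s_ge0.
elim: m V ec => [|m IH] V ec hV.
  have := hV 0%N isT; rewrite ltr0n => /card_gt0P[v vV].
  exists (fun=> v); split=> [j|i j]; rewrite leqn0; first by move/eqP->.
  by case: j => [|j]; rewrite ?andbF.
(* Shrinking the sets to a common size n makes the errors comparable. *)
have [n [nV hn]] : exists n : nat, (forall j, (j <= m.+1)%N -> (n <= #|V j|)%N) /\
   clique_bound m.+1 < n%:R.
  case: (@arg_minnP 'I_m.+2 ord0 predT (fun j => #|V j|) isT) => j0 _ min.
  exists #|V j0|; split; last by apply: hV; rewrite -ltnS.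
  by move=> j jm; exact: (min (Ordinal (jm : (j < m.+2)%N))).
pose W j := [set x in take n (enum (V j))].
have WV j : W j \subset V j.
  by apply/subsetP => x; rewrite inE => /mem_take; rewrite mem_enum.
have cW j : (j <= m.+1)%N -> #|W j| = n by move=> /nV; exact: card_take_enum.
have n_gt0 : (0 < n)%N by rewrite -(ltr0n R); exact: le_lt_trans (clique_bound_ge0 _) hn.
pose E j v := cyc_conv (ec 0%N j) (fun u => (u \in W j)%:R) v.
pose B := m.+1%:R * (D - 1) * s.
have B0 : 0 <= B by rewrite !mulr_ge0 //; lra.
have [v vW hv] : exists2 v, v \in W 0%N &
    \sum_(j < m.+1) E j.+1 v ^+ 2 <= B ^+ 2.
  case: (pickP [pred v in W 0%N | \sum_(j < m.+1) E j.+1 v ^+ 2 <= B ^+ 2]).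
    by move=> v /andP[vW hv]; exists v.
  move=> none; exfalso.
  have big v : v \in W 0%N -> 0 < \sum_(j < m.+1) E j.+1 v ^+ 2 - B ^+ 2.
    by move=> vW; have := none v; rewrite /= vW /= subr_gt0 => /negbT; rewrite -ltNge.
  have : 0 < \sum_(v in W 0%N) (\sum_(j < m.+1) E j.+1 v ^+ 2 - B ^+ 2).
    have /card_gt0P[v0 v0W] : (0 < #|W 0%N|)%N by rewrite cW.
    rewrite (bigD1 v0) //= ltr_wpDr ?big // sumr_ge0 // => v /andP[vW _].
    exact/ltW/big.
  rewrite sumrB sumr_const cW // subr_gt0 exchange_big /=; apply/negP; rewrite -leNgt.
  have le1 (j : 'I_m.+1) :
      \sum_(v in W 0%N) E j.+1 v ^+ 2 <= (D - 1) ^+ 2 * s ^+ 2 * n%:R.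
    apply: (@le_trans _ _ (\sum_v E j.+1 v ^+ 2)).
      rewrite [leLHS]big_mkcond; apply: ler_sum => v _.
      by case: ifP => // _; exact: sqr_ge0.
    apply: le_trans (cyc_conv_bound _ _) _.
    rewrite -mulrA ler_wpM2l ?sqr_ge0 // s_sqr.
    under eq_bigr do rewrite -natrX -mulnn mulnb andbb.
    by rewrite sum_mem cW // gerBl sqr_ge0.
  apply: le_trans (ler_sum _ (fun j _ => le1 j)) _.
  rewrite sumr_const card_ord -[leLHS]mulr_natl -[leRHS]mulr_natl mulrA mulrC.
  rewrite ler_wpM2l // /B !exprMn mulrA ler_wpM2r ?sqr_ge0 //.
  by rewrite ler_wpM2r ?sqr_ge0 // -natrX ler_nat -mulnn leq_pmulr.
pose V' j := [set u in W j.+1 | v - u \in cyc (ec 0%N j.+1)].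
have [j jm|x [xV xE]] := IH V' (fun i j => ec i.+1 j.+1).
  have Ej : E j.+1 v ^+ 2 <= B ^+ 2.
    apply: le_trans hv; rewrite (bigD1 (Ordinal (jm : (j < m.+1)%N))) //= lerDl.
    by apply: sumr_ge0 => i _; exact: sqr_ge0.
  have : - B <= E j.+1 v.
    rewrite lerNl; apply: le_trans (ler_norm _) _; rewrite normrN.
    by rewrite -(ger0_norm B0) -ler_sqr ?nnegrE // !real_normK ?num_real.
  rewrite /E cyc_conv_set cW // -(ltr_pM2l D0).
  move: hn; rewrite /= -/B /V'.
  by case: (v \in _) => /=; lra.
exists (fun j => if j is j'.+1 then x j' else v); split=> [[|j] jm|[|i] [|j] //= ij].
- by apply: (subsetP (WV 0%N)).
- by have := xV j jm; rewrite inE => /andP[+ _]; apply: (subsetP (WV j.+1)).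
- by have := xV j ij; rewrite inE => /andP[].
- exact: xE.
Qed.

(** The element 0 acts as an additional vertex, joined to the x j by edges whose colors are
    the classes vc j. The first step uses cyc_number_ge, which is sharper than the bound
    that clique_in_sets uses; without it the condition q > Q(d, k) would be too weak when
    k = 2, and when k = d = 3. *)
Lemma colored_clique k : (2 <= k)%N ->
  D ^+ 2 * clique_bound k.-2 < s ^+ 2 - 2 * D - (D - 1) ^+ 2 * s ->
  forall (vc : nat -> 'Z_d) (ec : nat -> nat -> 'Z_d),
  exists x : nat -> F, (forall j, (j < k)%N -> x j \in cyc (vc j)) /\
    (forall i j, (i < j < k)%N -> x i - x j \in cyc (ec i j)).
Proof.
case: k => [|[|m]] //= _ hm vc ec.
have /card_gt0P[v vC] := card_cyc_gt0 (vc 0%N).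
have v0 : v != 0 by move: vC; rewrite inE => /andP[].
have D2 : 0 < D ^+ 2 by rewrite exprn_gt0 // (lt_trans ltr01 D_gt1).
pose V j := [set u in cyc (vc j.+1) | v - u \in cyc (ec 0%N j.+1)].
have [j jm|x [xV xE]] := @clique_in_sets m V (fun i j => ec i.+1 j.+1).
  by rewrite -(ltr_pM2l D2) (lt_le_trans hm) // cyc_number_ge.
exists (fun j => if j is j'.+1 then x j' else v); split=> [[|j] jm|[|i] [|j] //= ij].
- by [].
- by have := xV j jm; rewrite inE => /andP[].
- by have := xV j ij; rewrite inE => /andP[].
- exact: xE.
Qed.

End Cyclotomy.

(** * The bound Q(d, m) *)

Section Numerics.
Variables (R : rcfType) (d : nat).
Hypothesis d_gt1 : (1 < d)%N.
Local Notation D := (d%:R : R).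

Lemma UboundE m : (0 < m)%N ->
  Ubound R d m = m%:R * (D - 1) * D ^+ m.-1 - D ^+ m + 1.
Proof.
move=> m0; rewrite /Ubound.
pose x : R := D - 1.
have e1 : \sum_(0 <= h < m.+1) 'C(m, h)%:R * x ^+ h = D ^+ m.
  rewrite big_mkord -[D](subrK 1) addrC exprDn; apply: eq_bigr => h _.
  by rewrite expr1n mul1r mulr_natl.
have e2 : \sum_(0 <= h < m.+1) 'C(m, h)%:R * x ^+ h * h%:R = m%:R * x * D ^+ m.-1.
  rewrite big_nat_recl // mulr0 add0r.
  have -> : D ^+ m.-1 = \sum_(0 <= h < m) 'C(m.-1, h)%:R * x ^+ h.
    rewrite -{2}(prednK m0) big_mkord -[D](subrK 1) addrC exprDn; apply: eq_bigr => h _.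
    by rewrite expr1n mul1r mulr_natl.
  rewrite mulr_sumr; apply: eq_bigr => h _.
  have e := mul_bin_diag m h.
  have {}e : m%:R * 'C(m.-1, h)%:R = h.+1%:R * 'C(m, h.+1)%:R :> R by rewrite -!natrM e.
  transitivity (h.+1%:R * 'C(m, h.+1)%:R * (x * x ^+ h)); first by rewrite exprS; ring.
  by rewrite -e; ring.
have e3 : \sum_(0 <= h < m.+1) 'C(m, h)%:R * x ^+ h * (h%:R - 1) =
    m%:R * x * D ^+ m.-1 - D ^+ m.
  by rewrite -e2 -e1 -sumrB; apply: eq_bigr => h _; ring.
by rewrite -e3 [in RHS]big_nat_recl // bin0 expr0 big_add1 /=; ring.
Qed.

Lemma Ubound_ge0 m : 0 <= Ubound R d m.
Proof.
rewrite /Ubound big_add1 big_mkord; apply: sumr_ge0 => h _.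
rewrite !mulr_ge0 ?exprn_ge0 //.
  by rewrite subr_ge0 ler1n ltnW.
by rewrite -natr1 addrK.
Qed.

(** Q(d, m) is the square of the positive root of X^2 - U X - d^(m-1) m. *)
Lemma Qbound_sqrt m (y : R) : 0 <= y -> Qbound R d m < y ->
  Ubound R d m * Num.sqrt y + D ^+ m.-1 * m%:R < y.
Proof.
move=> y0; rewrite /Qbound; set U := Ubound R d m; set w := D ^+ m.-1 * m%:R.
have U0 : 0 <= U := Ubound_ge0 m.
have w0 : 0 <= w by rewrite mulr_ge0 ?exprn_ge0.
have -> : 4 * D ^+ m.-1 * m%:R = 4 * w by rewrite mulrA.
set t := Num.sqrt (_ + _); set s := Num.sqrt y.
have t2 : t ^+ 2 = U ^+ 2 + 4 * w by rewrite sqr_sqrtr //; have := sqr_ge0 U; lra.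
have s2 : s ^+ 2 = y by rewrite sqr_sqrtr.
have s0 : 0 <= s := sqrtr_ge0 y.
have t0 : 0 <= t := sqrtr_ge0 _.
move=> lt; have : (U + t) / 2 < s.
  rewrite -ltr_sqr ?nnegrE ?divr_ge0 ?addr_ge0 // s2; apply: le_lt_trans lt.
  by rewrite expr_div_n; lra.
move=> {}lt.
have Ut : U <= t by rewrite -ler_sqr ?nnegrE // t2 lerDl mulr_ge0.
have : 0 < (s - (U + t) / 2) * (s - (U - t) / 2) by apply: mulr_gt0; lra.
rewrite -s2; lra.
Qed.

Lemma clique_bound_le (s : R) k : (2 <= k)%N -> 0 <= s ->
  D ^+ 2 * clique_bound d s k.-2 + 2 * D + (D - 1) ^+ 2 * s <=
  Ubound R d k * s + D ^+ k.-1 * k%:R.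
Proof.
case: k => [|[|m]] // _ s0 /=; rewrite UboundE //=.
have D2 : 2 <= D by rewrite (ler_nat R 2).
elim: m => [|m IH]; first by rewrite /=; lra.
have pow : m.+1%:R <= D ^+ m.
  elim: m {IH} => // m IH; rewrite -natr1 exprS.
  have : 1 <= m.+1%:R :> R by rewrite ler1n.
  have : 2 * D ^+ m <= D * D ^+ m by rewrite ler_wpM2r // exprn_ge0 //; lra.
  lra.
move: IH; rewrite /= !exprS -![m.+3%:R]natr1 -![m.+2%:R]natr1.
set a : R := m.+1%:R in pow *; set p := D ^+ m in pow *; set T := clique_bound d s m => IH.
have D0 : 0 <= D by lra.
have i1 := ler_wpM2l D0 IH.
have i2 : 0 <= (D - 2) * D * (D - 1) * s by rewrite !mulr_ge0 //; lra.
have i3 : 0 <= (p - a) * (D ^+ 2) * (D - 1) * s by rewrite !mulr_ge0 ?sqr_ge0 //; lra.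
have i4 : 0 <= (D - 2) * D by rewrite !mulr_ge0 //; lra.
have i5 : 0 <= D ^+ 2 * p by rewrite mulr_ge0 ?exprn_ge0 ?sqr_ge0.
move: i1 i2 i3 i4 i5; rewrite expr0 !mulr1; lra.
Qed. 

End Numerics.

(** There are k field elements in prescribed classes whose differences are in prescribed
    classes. The Weil bound would even allow the first k - 1 of them to be given in
    advance. *)
Lemma exists_colored_clique (R : rcfType) (F : finFieldType) (d : nat) (cl : F -> 'Z_d) :
  (1 < d)%N ->
  (forall x y, x != 0 -> y != 0 -> cl (x * y) = cl x + cl y) ->
  (forall c, exists2 x, x != 0 & cl x = c) ->
  forall k, (2 <= k)%N -> Qbound R d k < #|F|%:R ->
  forall (vc : nat -> 'Z_d) (ec : nat -> nat -> 'Z_d),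
  exists x : nat -> F, (forall j, (j < k)%N -> x j \in cyc cl (vc j)) /\
    (forall i j, (i < j < k)%N -> x i - x j \in cyc cl (ec i j)).
Proof.
move=> d1 clM cl_onto k k2 hQ.
pose s : R := Num.sqrt #|F|%:R.
have s2 : s ^+ 2 = #|F|%:R by rewrite sqr_sqrtr.
have hQ' := Qbound_sqrt d1 (ler0n R #|F|) hQ.
have hU := Ubound_ge0 R d1 k.
have s0 : 0 <= s := sqrtr_ge0 _.
have tb := clique_bound_le d1 k2 s0.
apply: (colored_clique d1 clM cl_onto (s := s)) => //; last first.
  by rewrite s2; move: hQ' tb; rewrite -/s; lra.
rewrite -ler_sqr ?nnegrE // s2.
apply: le_trans (ltW hQ'); rewrite -[leLHS]add0r lerD ?mulr_ge0 // -!natrX -natrM ler_nat.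
case: (k) k2 => [|[|k']] // _; rewrite leq_mul //= expnS (leq_trans d1) // leq_pmulr //.
by rewrite expn_gt0 ltnW.
Qed.

(** * Discrete logarithms *)

Lemma discrete_log (F : finFieldType) (d : nat) : (1 < d)%N -> (d %| #|F|.-1)%N ->
  exists cl : F -> 'Z_d,
  [/\ forall x y, x != 0 -> y != 0 -> cl (x * y) = cl x + cl y,
      forall c, exists2 x, x != 0 & cl x = c
    & ~~ odd #|F|.-1 -> cl (-1) = (#|F|.-1)./2%:R].
Proof.
move=> d1 dn; set n := #|F|.-1 in dn *.
have n0 : (0 < n)%N by rewrite /n -subn1 subn_gt0 card_finNzRing_gt1.
have unity (x : F) : x != 0 -> x ^+ n = 1.
  move=> x0; apply: (mulfI x0); rewrite -exprS mulr1 /n prednK ?expf_card //.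
  exact: ltnW (card_finNzRing_gt1 F).
have /hasP[w _ wP] : has n.-primitive_root (enum (predC1 (0 : F))).
  apply: has_prim_root => //; rewrite ?enum_uniq //; last by rewrite -cardE cardC1.
  by apply/allP => x; rewrite mem_enum unity_rootE => x0; rewrite unity.
have w0 : w != 0.
  apply/eqP => w0; have := prim_expr_order wP; rewrite w0 expr0n eqn0Ngt n0.
  by move/eqP; rewrite eq_sym oner_eq0.
pose log (x : F) : nat := if [pick i : 'I_n | x == w ^+ i] is Some i then i else 0%N.
have logE x : x != 0 -> x = w ^+ log x.
  move=> /unity /(prim_rootP wP)[i ->]; rewrite /log.
  by case: pickP => [j /eqP //|/(_ i)]; rewrite eqxx.
have clX i : (log (w ^+ i))%:R = i%:R :> 'Z_d.
  have := logE (w ^+ i); rewrite expf_neq0 // => /(_ isT) /eqP.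
  rewrite (eq_prim_root_expr wP) => /eqP e.
  rewrite -[LHS]Zp_nat_mod // -[RHS]Zp_nat_mod //; congr (_%:R).
  by rewrite -(modn_dvdm _ dn) -e modn_dvdm.
exists (fun x => (log x)%:R); split.
- by move=> x y x0 y0; rewrite {1}(logE x x0) {1}(logE y y0) -exprD clX natrD.
- by move=> c; exists (w ^+ c); rewrite ?expf_neq0 // clX natr_Zp.
move=> n_even; rewrite -(clX n./2) /=; congr ((log _)%:R).
have n2 : (n./2 + n./2 = n)%N by rewrite addnn halfK (negbTE n_even) subn0.
have : (w ^+ n./2 - 1) * (w ^+ n./2 + 1) == 0.
  by rewrite -subr_sqr expr1n -exprM muln2 -addnn n2 (prim_expr_order wP) subrr.
rewrite mulf_eq0 subr_eq0 addr_eq0 => /orP[|/eqP -> //].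
rewrite -(expr0 w) (eq_prim_root_expr wP) mod0n modn_small; last by lia.
by move=> /eqP; lia.
Qed.

(** * Coloring differences compatibly with an involution *)

Section BalancedColoring.
Variables (X : finType) (G : finZmodType) (C : zmodType).
Variables (A : {set X}) (sg : X -> X) (lab : X -> G) (half : pred X).
Variables (ep : C) (L0 : seq C).
Hypothesis sgK : involutive sg.
Hypothesis sgA : forall x, (sg x \in A) = (x \in A).
Hypothesis half_sg : forall x, x \in A -> half (sg x) = ~~ half x.
Hypothesis lab_sg : forall x, lab (sg x) = - lab x.
Hypothesis ep2 : ep + ep = 0.
Hypothesis card_fib : forall g, #|[set x in A | lab x == g]| = (size L0).*2.

(** The elements of A carry labels in G, and the involution sg exchanges the labels g and
    -g. A coloring that sg shifts by ep can have the color multiset L0 + (L0 shifted by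
    ep) on each label: for g <> -g it is free on one of the two labels, and for g = -g it
    is free on half of the elements. *)
Lemma balanced_coloring : exists col : X -> C,
  (forall x, x \in A -> col (sg x) = col x + ep) /\
  (forall g, perm_eq [seq col x | x <- enum [set x in A | lab x == g]]
                     (L0 ++ [seq c + ep | c <- L0])).
Proof.
pose LL := L0 ++ [seq c + ep | c <- L0].
(* ch selects one element in each orbit of sg, in a way that depends only on the label
   when the label differs from its opposite. *)
pose pos (g : G) := (enum_rank g < enum_rank (- g))%N.
pose ch x := pos (lab x) || (lab x == - lab x) && half x.
have ch_sg x : x \in A -> ch (sg x) = ~~ ch x.
  move=> xA; rewrite /ch half_sg // lab_sg /pos opprK [- _ == _]eq_sym.
  case: ltngtP => [||/val_inj /enum_rank_inj] //= h.
  - by case: eqP h => // <-; rewrite ltnn.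
  - by case: eqP h => // <-; rewrite ltnn.
  - by rewrite h eqxx.
pose Y g := [set x in A | (lab x == g) && ch x].
pose L (g : G) := if g == - g then L0 else LL.
pose base x := nth 0 (L (lab x)) (index x (enum (Y (lab x)))).
pose col x := if ch x then base x else base (sg x) + ep.
have mapY g : #|Y g| = size (L g) -> map col (enum (Y g)) = L g.
  move=> cY; rewrite -[RHS](@map_nth_index _ _ 0 (enum (Y g))) ?enum_uniq -?cardE //.
  apply/eq_in_map => x; rewrite mem_enum inE => /and3P[_ /eqP xg xc].
  by rewrite /col xc /base xg.
have colsg x : x \in A -> col (sg x) = col x + ep.
  move=> xA; rewrite /col ch_sg //; case: (ch x); rewrite /= ?sgK //.
  by rewrite -addrA ep2 addr0.
have LLep : perm_eq [seq c + ep | c <- LL] LL.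
  rewrite /LL map_cat -map_comp perm_catC perm_cat2r.
  rewrite (eq_map (g := id)) ?map_id // => c /=.
  by rewrite -addrA ep2 addr0.
have mapsg (B : {set X}) : B \subset A ->
    [seq col x | x <- [seq sg x | x <- enum B]] = [seq c + ep | c <- [seq col x | x <- enum B]].
  move=> BA; rewrite -!map_comp; apply/eq_in_map => x; rewrite mem_enum => xB /=.
  by rewrite colsg // (subsetP BA).
exists col; split=> // g; rewrite -/LL.
have YA h : Y h \subset A by apply/subsetP => x; rewrite inE => /andP[].
have memsg (B : {set X}) x : (x \in [seq sg x | x <- enum B]) = (sg x \in B).
  by rewrite -{1}[x]sgK mem_map ?mem_enum //; exact: inv_inj.
have [gg|gg] := eqVneq g (- g).
  have e : perm_eq (enum [set x in A | lab x == g])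
     (enum (Y g) ++ [seq sg x | x <- enum (Y g)]).
    apply: uniq_perm; rewrite ?cat_uniq ?enum_uniq ?map_inj_uniq ?enum_uniq ?andbT //=.
    - apply/hasPn => x; rewrite memsg mem_enum !inE sgA.
      case: (boolP (x \in A)) => //= xA; rewrite ch_sg // => /andP[_ /negbTE ->].
      by rewrite andbF.
    - exact: inv_inj.
    move=> x; rewrite mem_cat memsg !mem_enum !inE sgA lab_sg.
    case: (boolP (x \in A)) => //= xA; rewrite ch_sg //.
    have -> : (- lab x == g) = (lab x == g) by rewrite [in LHS]gg eqr_opp.
    by case: (lab x == g) => //=; rewrite orbN.
  have cY : #|Y g| = size (L g).
    rewrite /L -gg eqxx; apply: double_inj; rewrite -(card_fib g) [in RHS]cardE (perm_size e).
    by rewrite size_cat size_map -cardE addnn.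
  apply: perm_trans (perm_map _ e) _; rewrite map_cat mapsg // mapY //.
  by rewrite /L -gg eqxx.
have pn : pos (- g) = ~~ pos g.
  rewrite /pos opprK; case: ltngtP => // /val_inj /enum_rank_inj h.
  by rewrite h eqxx in gg.
have szL h : h != - h -> size (L h) = #|[set x in A | lab x == h]|.
  by move=> /negbTE hh; rewrite card_fib /L hh size_cat size_map addnn.
have YE h : pos h -> Y h = [set x in A | lab x == h].
  move=> ph; apply/setP => x; rewrite !inE /ch; case: eqP => [->|]; rewrite ?andbF //.
  by rewrite ph.
have [pg|ng] := boolP (pos g).
  rewrite -YE // mapY; first by rewrite /L (negbTE gg).
  by rewrite szL // YE.
have gg' : - g != - - g by rewrite eqr_opp.
have e : perm_eq (enum [set x in A | lab x == g]) [seq sg x | x <- enum (Y (- g))].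
  apply: uniq_perm; rewrite ?enum_uniq ?map_inj_uniq ?enum_uniq //; first exact: inv_inj.
  by move=> x; rewrite memsg mem_enum YE ?pn // !inE sgA lab_sg eqr_opp.
apply: perm_trans (perm_map _ e) _; rewrite mapsg // mapY.
  by rewrite /L (negbTE gg').
by rewrite szL // YE // pn.
Qed.

End BalancedColoring.

(** * Development of base blocks by dilations *)

Section Dilation.
Variables (F : finFieldType) (d : nat) (cl : F -> 'Z_d).
Hypothesis clM : forall x y, x != 0 -> y != 0 -> cl (x * y) = cl x + cl y.
Variables (TL : seq 'Z_d) (S : pred 'Z_d).
(* Z_d is the direct sum of TL and S: each z is c + w, with c in TL and w in S, once. *)
Hypothesis tiling : forall z, count (fun c => S (z - c)) TL = 1%N.

(** The field elements by which the base blocks are dilated. *)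
Definition multipliers : {set F} := [set m | (m != 0) && S (cl m)].

(** If the logarithms of xs cover TL exactly n times, the dilates of xs cover F^* exactly
    n times. *)
Lemma sum_dilates n (xs : seq F) : all (fun x => x != 0) xs ->
  perm_eq [seq cl x | x <- xs] (flatten (nseq n TL)) ->
  forall y, (\sum_(x <- xs) \sum_(m in multipliers) (m * x == y)%R = n * (y != 0%R))%N.
Proof.
move=> xs0 xsT y; have [->|y0] := eqVneq y 0.
  rewrite muln0 big_seq big1 // => x /(allP xs0) x0; apply: big1 => m.
  by rewrite inE => /andP[m0 _]; rewrite mulf_eq0 (negbTE m0) (negbTE x0).
rewrite muln1.
transitivity (count (fun c => S (cl y - c)) [seq cl x | x <- xs]).
  rewrite count_map count_sum big_seq [RHS]big_seq; apply: eq_bigr => x /(allP xs0) x0.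
  rewrite /= -(cl_div clM) //.
  have e m : (m * x == y) = (m == y / x) by rewrite -(can2_eq (mulfK x0) (divfK x0)).
  under eq_bigr do rewrite e.
  rewrite big_mkcond (bigD1 (y / x)) //= big1 ?addn0.
    by rewrite inE mulf_neq0 ?invr_neq0 //= eqxx; case: (S _).
  by move=> m /negbTE ->; case: ifP.
by rewrite (permP xsT) count_nseq_flatten tiling muln1.
Qed.

End Dilation.

Section Construction.
(* The difference family is indexed by 'I_M * 'I_t: it consists of M groups of t members,
   each of which gives rise to one subfamily of base blocks. *)
Variables (G : finZmodType) (F : finFieldType) (d k t M lam : nat) (cl : F -> 'Z_d).
Hypothesis clM : forall x y, x != 0 -> y != 0 -> cl (x * y) = cl x + cl y.
Variables (TL : seq 'Z_d) (S : pred 'Z_d).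
Hypothesis tiling : forall z, count (fun c => S (z - c)) TL = 1%N.
Variable f : 'I_M * 'I_t -> k.-tuple G.
Variable phi : 'I_M * 'I_t -> 'I_k -> F.
Hypothesis MG : (M * k.-1 = lam * #|G|)%N.
Hypothesis phi_neq0 : forall p j, phi p j != 0.
Hypothesis phi_neq : forall p i j, i != j -> phi p i - phi p j != 0.
Hypothesis phi_vertex : forall u : 'I_M,
  perm_eq [seq cl (phi (u, vj.1) vj.2) | vj : 'I_t * 'I_k <- enum {: 'I_t * 'I_k}] TL.

(** The positions at which the difference g occurs in the difference family. *)
Definition slots g : {set ('I_M * 'I_t) * ('I_k * 'I_k)} :=
  [set x | (x.2.1 != x.2.2) && (tnth (f x.1) x.2.1 - tnth (f x.1) x.2.2 == g)].

Hypothesis phi_edge : forall g,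
  perm_eq [seq cl (phi x.1 x.2.1 - phi x.1 x.2.2) | x <- enum (slots g)]
     (flatten (nseq lam TL)).

Local Notation H := (G * F : finZmodType)%type.
Local Notation N := (setX [set: G] [set (0 : F)]).
Local Notation D := (multipliers cl S).

(** The j-th element of the base block of index p dilated by m. *)
Definition blk_pt p (m : F) (j : 'I_k) : G * F := (tnth (f p) j, m * phi p j).
Definition blk p m : {set G * F} := [set blk_pt p m j | j : 'I_k].

(** The subfamily of all the dilates of the t base blocks of the group u. *)
Definition subfam (u : 'I_M) : seq {set G * F} :=
  [seq blk (u, v) m | v <- enum 'I_t, m <- enum D].

Lemma multipliers_neq0 m : m \in D -> m != 0. Proof. by rewrite inE => /andP[]. Qed.

Lemma blk_pt_inj p m : m != 0 -> injective (blk_pt p m).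
Proof.
move=> m0 i j [_ /(mulfI m0) e]; apply/eqP; apply: contraTT isT => /(phi_neq p).
by rewrite e subrr eqxx.
Qed.

Lemma sum_blk p m (W : G * F -> nat) : m \in D ->
  (\sum_(h in blk p m) W h = \sum_j W (blk_pt p m j))%N.
Proof.
move=> /multipliers_neq0 m0; rewrite big_imset //=; by move=> ? ? _ _; exact: blk_pt_inj.
Qed.

Lemma card_blk p m : m \in D -> #|blk p m| = k.
Proof. by move=> /multipliers_neq0 m0; rewrite card_imset ?card_ord //; exact: blk_pt_inj. Qed.

Lemma sum_subfam (W : {set G * F} -> nat) u :
  (\sum_(B <- subfam u) W B = \sum_v \sum_(m in D) W (blk (u, v) m))%N.
Proof.
rewrite /subfam big_allpairs_dep /= big_enum /=; apply: eq_bigr => v _.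
by rewrite big_enum.
Qed.

(** The second components of the blocks of a subfamily cover F^* exactly once. *)
Lemma count_snd_subfam u (y : F) :
  (\sum_(B <- subfam u) \sum_(h in B) (h.2 == y) = (y != 0%R))%N.
Proof.
rewrite sum_subfam.
pose xs := [seq phi (u, vj.1) vj.2 | vj : 'I_t * 'I_k <- enum {: 'I_t * 'I_k}].
have := @sum_dilates _ _ _ clM TL S tiling 1 xs _ _ y; rewrite mul1n => <-.
- rewrite big_map big_enum /=.
  rewrite -(pair_bigA _ (fun v j => \sum_(m in D) (m * phi (u, v) j == y)%R)%N) /=.
  apply: eq_bigr => v _; rewrite exchange_big /=; apply: eq_bigr => m mD.
  by rewrite sum_blk.
- by apply/allP => x /mapP[vj _ ->].
- by rewrite -map_comp /= cats0; exact: phi_vertex.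
Qed.

Lemma size_subfam u : (size (subfam u) * k = #|F|.-1)%N.
Proof.
transitivity (\sum_(B <- subfam u) \sum_(h in B) 1)%N.
  transitivity (\sum_(B <- subfam u) k)%N.
    by rewrite big_const_seq iter_addn_0 count_predT mulnC.
  rewrite !sum_subfam; apply: eq_bigr => v _.
  by apply: eq_bigr => m mD; rewrite sum1_card card_blk.
transitivity (\sum_(y : F) (y != 0%R))%N; last first.
  rewrite -(cardC1 (0 : F)) -sum1_card [RHS]big_mkcond /=.
  by apply: eq_bigr => y _; rewrite inE; case: (y == 0).
under [RHS]eq_bigr do rewrite -(count_snd_subfam u).
rewrite exchange_big /=; apply: eq_bigr => B _.
rewrite exchange_big /=; apply: eq_bigr => h _.
by rewrite (bigD1 h.2) //= eqxx big1 // => y /negbTE; rewrite eq_sym => ->.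
Qed.

Lemma add_cosetE (h : G * F) : @add_coset H N h = setX [set: G] [set h.2].
Proof.
apply/setP => -[g y]; rewrite !inE /=; apply/imsetP/eqP => [[[g' y']]|->].
  by rewrite !inE /= => /eqP -> [_ ->]; rewrite addr0.
exists (g - h.1, 0); rewrite ?inE /= ?eqxx //; case: h => a b.
suff -> : (a, b) + (g - a, 0) = (a + (g - a), b + 0) :> H by rewrite addr0 addrC subrK.
by [].
Qed.

(** The coset of the elements with second component y. *)
Definition fiber_coset (y : F) : {set G * F} := setX [set: G] [set y].

Lemma fiber_coset_inj : injective fiber_coset.
Proof.
move=> y y' e; have : (0, y) \in fiber_coset y' by rewrite -e !inE /=.
by rewrite !inE /= => /eqP.
Qed.

Lemma subfam_reps u :
  @nontrivial_coset_reps H N (flatten [seq enum B | B : {set G * F} <- subfam u]).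
Proof.
rewrite /nontrivial_coset_reps.
set L := flatten _.
have -> : map (@add_coset H N) L = map fiber_coset (map snd L).
  by rewrite -map_comp; apply: eq_map => h; exact: add_cosetE.
have e : perm_eq (map snd L) (enum (predC1 (0 : F))).
  apply: count_mem_perm => y; rewrite [RHS]count_uniq_mem ?enum_uniq // mem_enum inE.
  rewrite -(count_snd_subfam u y) count_map count_sum /L big_flatten /= big_map.
  by apply: eq_bigr => B _; rewrite big_enum.
apply: perm_trans (perm_map _ e) _.
apply: uniq_perm; rewrite ?enum_uniq ?map_inj_uniq ?enum_uniq //; first exact: fiber_coset_inj.
move=> B; rewrite mem_enum; apply/mapP/imsetP => [[y]|[h hN ->]].
  rewrite mem_enum inE => y0 ->; exists (0, y); first by rewrite !inE.
  by rewrite add_cosetE.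
exists h.2; last by rewrite add_cosetE.
by move: hN; rewrite mem_enum !inE.
Qed.

Lemma count_block_diffs p m g y : m \in D ->
  count_mem (g, y) (@block_diffs H (blk p m)) =
  (\sum_(ij : 'I_k * 'I_k | (ij.1 != ij.2) && (tnth (f p) ij.1 - tnth (f p) ij.2 == g)%R)
     (m * (phi p ij.1 - phi p ij.2) == y)%R)%N.
Proof.
move=> mD; have m0 := multipliers_neq0 mD.
rewrite count_sum big_allpairs_dep /= big_enum /= sum_blk //.
transitivity (\sum_i \sum_j ((i != j) && (tnth (f p) i - tnth (f p) j == g)%R)
    * (m * (phi p i - phi p j) == y)%R)%N.
  apply: eq_bigr => i _; rewrite big_enum /=.
  transitivity (\sum_(h in blk p m) (h != blk_pt p m i) * ((blk_pt p m i - h)%R == (g, y)))%N.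
    rewrite big_mkcond [RHS]big_mkcond /=; apply: eq_bigr => h _.
    by rewrite in_setD1; case: (h \in blk p m); case: (h == _); rewrite ?mul1n ?mul0n.
  rewrite (sum_blk p (fun h : G * F =>
    (h != blk_pt p m i) * ((blk_pt p m i - h)%R == (g, y)))%N mD).
  apply: eq_bigr => j _.
  rewrite (inj_eq (@blk_pt_inj p m m0)) eq_sym mulrBr; case: (i != j) => //.
  by rewrite mul1n -pair_eqE /pair_eq /= mulnb.
rewrite pair_bigA /= [RHS]big_mkcond /=; apply: eq_bigr => -[i j] _ /=.
by case: (_ && _); rewrite ?mul1n.
Qed.

(** The dilates of the blocks {(f_j, phi_j)} form a frame difference family. *)
Lemma dilates_FDF : exists BB : seq {set H}, is_FDF N k lam BB.
Proof.
pose P := [seq subfam u | u <- enum 'I_M].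
exists (flatten P); split; last first.
  exists P; split=> //.
    by rewrite size_map size_enum_ord MG cardsX cardsT cards1 muln1.
  move=> C /mapP[u _ ->]; split; last exact: subfam_reps.
  rewrite cardsX cardsT cards1 muln1 card_prod mulnC -mulnA [(k * _)%N]mulnC size_subfam.
  by rewrite -subn1 mulnBr muln1.
split.
- split; first by rewrite in_setX !inE /= eqxx.
  by move=> x y; rewrite !in_setX !inE /= => /eqP x0 /eqP y0; rewrite x0 y0 subrr.
- apply/allP => B /flatten_mapP[u _ /allpairsP[[v m] [_ mD ->]]].
  by rewrite /= card_blk // -mem_enum.
apply: count_mem_perm => -[g y]; rewrite count_copies.
have -> : ((g, y) \in ~: N) = (y != 0) by rewrite !inE.
transitivity (\sum_(p : 'I_M * 'I_t) \sum_(m in D)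
    count_mem (g, y) (@block_diffs H (blk p m)))%N.
  rewrite count_flatten sumnE !big_map big_flatten /= big_map big_enum /=.
  transitivity (\sum_u \sum_v \sum_(m in D) count_mem (g, y) (@block_diffs H (blk (u, v) m)))%N.
    by apply: eq_bigr => u _; rewrite sum_subfam.
  by rewrite pair_bigA /=; apply: eq_bigr => -[u v].
pose xs := [seq phi x.1 x.2.1 - phi x.1 x.2.2 | x <- enum (slots g)].
rewrite -(@sum_dilates _ _ _ clM TL S tiling lam xs).
- rewrite big_map big_enum /=.
  transitivity (\sum_p \sum_(ij : 'I_k * 'I_k |
       (ij.1 != ij.2) && (tnth (f p) ij.1 - tnth (f p) ij.2 == g)%R)
     \sum_(m in D) (m * (phi p ij.1 - phi p ij.2) == y)%R)%N.
    apply: eq_bigr => p _; rewrite exchange_big /=; apply: eq_bigr => m mD.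
    by rewrite count_block_diffs.
  rewrite pair_big_dep /=; apply: eq_bigl => -[p [i j]].
  by rewrite !inE.
- apply/allP => x /mapP[[p [i j]]]; rewrite mem_enum inE /= => /andP[ij _] ->.
  exact: phi_neq.
- by rewrite -map_comp; exact: phi_edge.
Qed.

End Construction.

(** * From a strong to a frame difference family *)

Lemma sum_sdf_diffs (G : zmodType) k (h : k.-tuple G) (W : G -> nat) :
  (\sum_(z <- sdf_diffs h) W z =
   \sum_(ij : 'I_k * 'I_k | ij.1 != ij.2) W (tnth h ij.1 - tnth h ij.2)%R)%N.
Proof.
rewrite /sdf_diffs big_allpairs_dep /= big_enum /=.
transitivity (\sum_i \sum_(j | i != j) W (tnth h i - tnth h j)%R)%N.
  apply: eq_bigr => i _; rewrite big_enum /=; apply: eq_bigl => j.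
  by rewrite inE eq_sym.
by rewrite pair_big_dep.
Qed.

Lemma size_sdf_diffs (G : zmodType) k (h : k.-tuple G) :
  size (sdf_diffs h) = (k * k.-1)%N.
Proof.
rewrite size_allpairs_dep sumnE big_map big_enum /=.
under eq_bigr => i _ do rewrite -cardE cardC1 card_ord.
by rewrite sum_nat_const card_ord.
Qed.

(** The difference family has M * t members, with M = lam |G| / (k - 1), so that it can be
    indexed by M groups of t members. *)
Lemma SDF_family (G : finZmodType) (k t lam M : nat) (Sf : seq (k.-tuple G)) :
  (1 < k)%N -> (M * k.-1 = lam * #|G|)%N -> is_SDF (k * t * lam) Sf ->
  exists f : 'I_M * 'I_t -> k.-tuple G, forall g, #|slots f g| = (k * t * lam)%N.
Proof.
move=> k1 MG sdf.
have k1' : (0 < k.-1)%N by rewrite -subn1 subn_gt0.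
have cG : size (enum [set: G]) = #|G| by rewrite -cardE; exact: cardsT.
have sz : size Sf = (M * t)%N.
  have := perm_size sdf; rewrite !size_flatten /shape map_nseq sumn_nseq cG.
  rewrite -map_comp sumnE big_map.
  under eq_bigr => h _ do rewrite /= size_sdf_diffs.
  rewrite big_const_seq iter_addn_0 count_predT => e.
  apply/eqP; rewrite -(@eqn_pmul2l (k * k.-1)) ?muln_gt0 ?k1' ?(ltnW k1) //; apply/eqP.
  rewrite e; have -> : (#|G| * (k * t * lam) = k * t * (lam * #|G|))%N by lia.
  by rewrite -MG; lia.
have [f fE] : exists f : 'I_M * 'I_t -> k.-tuple G, Sf = [seq f i | i <- enum {: 'I_M * 'I_t}].
  by apply: seq_as_family; rewrite card_prod !card_ord sz.
exists f => g; have := permP sdf (pred1 g).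
rewrite count_copies inE muln1 => <-.
rewrite fE count_flatten -map_comp sumnE 2!big_map big_enum /= -sum1_card.
transitivity (\sum_p \sum_(ij : 'I_k * 'I_k | ij.1 != ij.2)
   (tnth (f p) ij.1 - tnth (f p) ij.2 == g)%R)%N; last first.
  by apply: eq_bigr => p _; rewrite count_sum sum_sdf_diffs.
rewrite pair_big_dep /= [LHS]big_mkcond [RHS]big_mkcond /=; apply: eq_bigr => -[p ij] _ /=.
by rewrite inE /=; case: (_ != _); case: (_ == _).
Qed.

(** The construction, for any direct decomposition of Z_d into TL and S such that lam copies
    of TL are of the form L0 + (L0 shifted by the logarithm of -1). *)
Lemma SDF_to_FDF (R : rcfType) (G : finZmodType) (F : finFieldType) (k t lam d : nat)
    (cl : F -> 'Z_d) (TL L0 : seq 'Z_d) (S : pred 'Z_d) :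
  (1 < k)%N -> (k.-1 %| lam * #|G|)%N ->
  (exists Sf : seq (k.-tuple G), is_SDF (k * t * lam) Sf) ->
  (1 < d)%N ->
  (forall x y, x != 0 -> y != 0 -> cl (x * y) = cl x + cl y) ->
  (forall c, exists2 x, x != 0 & cl x = c) ->
  Qbound R d k < #|F|%:R ->
  size TL = (k * t)%N ->
  (forall z, count (fun c => S (z - c)) TL = 1%N) ->
  perm_eq (L0 ++ [seq c + cl (-1) | c <- L0]) (flatten (nseq lam TL)) ->
  exists BB : seq {set (G * F : finZmodType)},
    is_FDF (setX [set: G] [set (0 : F)]) k lam BB.
Proof.
move=> k1 kdiv [Sf sdf] d1 clM cl_onto hQ szTL tiling L0T.
have /dvdnP[M /esym MG] := kdiv.
have [f f_card] := SDF_family k1 MG sdf.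
pose X := (('I_M * 'I_t) * ('I_k * 'I_k))%type.
pose A : {set X} := [set x | x.2.1 != x.2.2].
pose sg (x : X) : X := (x.1, (x.2.2, x.2.1)).
pose lab (x : X) : G := tnth (f x.1) x.2.1 - tnth (f x.1) x.2.2.
pose half (x : X) := (x.2.1 < x.2.2)%N.
have n1 : (-1 : F) != 0 by rewrite oppr_eq0 oner_neq0.
have ep2 : cl (-1) + cl (-1) = 0 by rewrite -clM // mulrNN mulr1 (cl1 clM).
have fibE g : [set x in A | lab x == g] = slots f g by apply/setP => x; rewrite !inE.
have [col [col_sg col_fib]] : exists col : X -> 'Z_d,
   (forall x, x \in A -> col (sg x) = col x + cl (-1)) /\
   (forall g, perm_eq [seq col x | x <- enum [set x in A | lab x == g]]
                      (L0 ++ [seq c + cl (-1) | c <- L0])).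
  apply: (@balanced_coloring X G _ A sg lab half) => //.
  - by case=> ? [].
  - by move=> [p [i j]]; rewrite !inE eq_sym.
  - by move=> [p [i j]]; rewrite inE /half /= -leqNgt ltn_neqAle eq_sym => ->.
  - by move=> x; rewrite /lab opprB.
  - move=> g; rewrite fibE f_card -szTL.
    have := perm_size L0T; rewrite size_cat size_map addnn => ->.
    by rewrite size_flatten /shape map_nseq sumn_nseq.
have [tc tcE] : exists tc : 'I_t * 'I_k -> 'Z_d, TL = [seq tc i | i <- enum {: 'I_t * 'I_k}].
  by apply: seq_as_family; rewrite card_prod !card_ord szTL mulnC.
have k0 : 'I_k := Ordinal (ltnW k1).
have phi_ex (p : 'I_M * 'I_t) : exists x : 'I_k -> F,
    (forall j, x j \in cyc cl (tc (p.2, j))) /\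
    (forall i j, i != j -> x i - x j \in cyc cl (col (p, (i, j)))).
  have [x [xv xe]] := exists_colored_clique d1 clM cl_onto k1 hQ
    (fun j => tc (p.2, insubd k0 j)) (fun i j => col (p, (insubd k0 i, insubd k0 j))).
  have lt_edge (i j : 'I_k) : (i < j)%N -> x i - x j \in cyc cl (col (p, (i, j))).
    by move=> ij; have := xe i j; rewrite ij ltn_ord !valKd => /(_ isT).
  exists (fun j => x j); split=> [j|i j ij]; first by have := xv j (ltn_ord j); rewrite valKd.
  case: (ltngtP i j) => [|ji|/val_inj e]; first exact: lt_edge; last by rewrite e eqxx in ij.
  have := lt_edge _ _ ji; rewrite -(opprB (x j)) -[- (_ - _)]mulN1r (cyc_scale clM) //.
  have -> : col (p, (i, j)) = col (p, (j, i)) + cl (-1).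
    by rewrite -col_sg // inE /= eq_sym.
  by rewrite addrK.
have {phi_ex} [phi phiP] := fin_all_exists phi_ex.
have phi_v p j : phi p j \in cyc cl (tc (p.2, j)) by case: (phiP p).
have phi_e p i j : i != j -> phi p i - phi p j \in cyc cl (col (p, (i, j))).
  by case: (phiP p) => _; exact.
apply: (dilates_FDF clM tiling (f := f) (phi := phi)) => //.
- by move=> p j; have := phi_v p j; rewrite inE => /andP[].
- by move=> p i j /(phi_e p); rewrite inE => /andP[].
- move=> u; rewrite tcE (@eq_map _ _ _ tc) // => -[v j] /=.
  by have := phi_v (u, v) j; rewrite inE => /andP[_ /eqP].
move=> g; apply: perm_trans L0T; apply: perm_trans (col_fib g); rewrite fibE.
rewrite (@eq_in_map _ _ _ col _).1 // => -[p [i j]]; rewrite mem_enum inE /= => /andP[ij _].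
by have := phi_e p _ _ ij; rewrite inE => /andP[_ /eqP].
Qed.

(** For d = 2 e r, the set {0, e, 2 e, ..., (r - 1) e} of Z_d. *)
Definition tile (e r d : nat) (w : 'Z_d) : bool := (w < e * r)%N && (e %| w)%N.

(** Z_d is the direct sum of tile e r and of the union of {0, ..., e - 1} and its translate
    by e r = d / 2: the component of z in the latter is e r a + (z mod e), with
    a = z / (e r) rounded down. *)
Lemma tiling_Zd (e r d : nat) (z : 'Z_d) : (0 < e)%N -> (0 < r)%N -> d = (2 * (e * r))%N ->
  count (fun c : 'Z_d => tile e r (z - c))
    ([seq i%:R | i <- iota 0 e] ++ [seq i%:R + (e * r)%:R | i <- iota 0 e]) = 1%N.
Proof.
move=> e0 r0 dE.
have er0 : (0 < e * r)%N by rewrite muln_gt0 e0.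
have d1 : (1 < d)%N by lia.
pose c0 := (z %/ (e * r) * (e * r) + z %% e)%N.
have zd : (z < d)%N by have := ltn_ord z; rewrite [X in (_ < X)%N -> _](Zp_cast d1).
have -> : [seq (i%:R : 'Z_d) | i <- iota 0 e] ++ [seq i%:R + (e * r)%:R | i <- iota 0 e] =
   [seq i%:R | i <- iota 0 e ++ iota (e * r) e].
  have -> : iota (e * r) e = map (addn (e * r)) (iota 0 e) by rewrite -iotaDl addn0.
  rewrite map_cat -map_comp; congr (_ ++ _).
  by apply: eq_map => i /=; rewrite natrD addrC.
have er_ge : (e <= e * r)%N by rewrite leq_pmulr.
have memc c : (c \in iota 0 e ++ iota (e * r) e) ->
    exists a c1, [/\ c = a * (e * r) + c1, a < 2 & c1 < e]%N.
  rewrite mem_cat !mem_iota /= add0n => /orP[ce|/andP[c1 c2]].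
    by exists 0%N, c.
  by exists 1%N, (c - e * r)%N; split => //; lia.
have [y yE yer] : exists2 y, nat_of_ord z = (z %/ (e * r) * (e * r) + y)%N & (y < e * r)%N.
  by exists (z %% (e * r))%N; [rewrite -divn_eq | rewrite ltn_mod].
have a2 : (z %/ (e * r) < 2)%N by rewrite ltn_divLR // -dE.
have cz : (z %% e < e)%N by rewrite ltn_mod.
rewrite count_map; apply: (@count_eq1 _ _ _ c0).
- rewrite cat_uniq !iota_uniq andbT /=; apply/hasPn => c; rewrite !mem_iota; lia.
- by rewrite mem_cat !mem_iota /c0; case: (_ %/ _)%N a2 => [|[|?]] //=; lia.
move=> c /memc[a [c1 [cE a2' c1e]]].
change (tile e r (z - c%:R) = (c == c0)); rewrite /tile.
have cd : (c < d)%N by nia.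
have subE : nat_of_ord (z - c%:R) = ((z + (d - c)) %% d)%N.
  rewrite -(val_Zp_nat d1); congr nat_of_ord.
  rewrite natrD natrB ?(ltnW cd) // natr_Zp.
  have -> : d%:R = 0 :> 'Z_d by apply: val_inj; rewrite /= val_Zp_nat // modnn.
  by rewrite sub0r.
rewrite subE; set w := (_ %% d)%N.
have zw : nat_of_ord z = ((c + w) %% d)%N.
  rewrite /w modnDmr addnCA subnKC ?(ltnW cd) // modnDr modn_small //.
apply/andP/eqP => [[w1 /dvdnP[b wE]]|cc0].
  have br : (b < r)%N by rewrite -(@ltn_pmul2r e) // -wE mulnC.
  have lt : (c1 + b * e < e * r)%N by nia.
  move: zw; rewrite modn_small; last by nia.
  move=> zw; rewrite /c0.
  have -> : (z %/ (e * r) = a)%N.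
    by rewrite zw cE wE -addnA divnMDl // divn_small ?addn0.
  have -> : (z %% e = c1)%N.
    rewrite zw cE wE (_ : _ + _ = (a * r + b) * e + c1)%N; last by ring.
    by rewrite modnMDl modn_small.
  exact: cE.
have ze : (z %% e = y %% e)%N.
  by rewrite yE [(e * r)%N]mulnC mulnA modnMDl.
have wE : w = (y %/ e * e)%N.
  rewrite /w cc0 /c0 ze {1}yE.
  have := divn_eq y e => yy.
  rewrite (_ : _ + _ = y %/ e * e + d)%N; last first.
    by move: cd; rewrite cc0 /c0 ze; lia.
  by rewrite modnDr modn_small //; lia.
by rewrite wE dvdn_mull //; have := leq_trunc_div y e; lia.
Qed.

(** The difference 0 occurs an even number of times: exchanging the two indices pairs up its
    occurrences. *)
Lemma SDF_even (G : finZmodType) (k t lam : nat) (Sf : seq (k.-tuple G)) :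
  (1 < k)%N -> (k.-1 %| lam * #|G|)%N -> is_SDF (k * t * lam) Sf ->
  ~~ odd (k * t * lam).
Proof.
move=> k1 /dvdnP[M /esym MG] /(SDF_family k1 MG)[f f_card].
rewrite -(f_card 0); set A := slots f 0.
pose B := [set x : ('I_M * 'I_t) * ('I_k * 'I_k) | (x.2.1 < x.2.2)%N].
pose sg (x : ('I_M * 'I_t) * ('I_k * 'I_k)) := (x.1, (x.2.2, x.2.1)).
have sgK : involutive sg by case=> ? [].
rewrite -(cardsID B A); suff -> : #|A :\: B| = #|A :&: B| by rewrite addnn odd_double.
rewrite -(card_imset _ (inv_inj sgK)); apply: eq_card => -[p [i j]].
rewrite -[(p, (i, j))]sgK mem_imset ?inE /=; last exact: inv_inj.
rewrite ![j == i]eq_sym -[tnth _ j - _]opprB oppr_eq0.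
by case: ltngtP => [||/val_inj ->]; rewrite ?eqxx ?andbF ?andbT.
Qed.

Theorem theorem3p3 (R : rcfType) (G : finZmodType) (k t lambda : nat)
    (hk : (2 <= k)%N) (ht : (0 < t)%N) (hlambda : (0 < lambda)%N)
    (hdiv : (lambda * #|G| = 0 %[mod k.-1])%N)
    (hSDF : exists S : seq (k.-tuple G), is_SDF (k * t * lambda) S) :
  (~~ odd lambda ->
   forall (q : nat) (F : finFieldType), #|F| = q ->
     (q = 1 %[mod k * t])%N ->
     Qbound R (k * t) k < q%:R ->
     exists BB : seq {set (G * F : finZmodType)},
       is_FDF (setX [set: G] [set (0 : F)]) k lambda BB)
  /\
  (odd lambda ->
   forall (r : nat), (0 < r)%N ->
   forall (q : nat) (F : finFieldType), #|F| = q ->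
     (q = k * r * t + 1 %[mod 2 * (k * r * t)])%N ->
     Qbound R (k * r * t) k < q%:R ->
     exists BB : seq {set (G * F : finZmodType)},
       is_FDF (setX [set: G] [set (0 : F)]) k lambda BB).
Proof.
have kdiv : (k.-1 %| lambda * #|G|)%N by rewrite /dvdn hdiv mod0n.
split=> [lam_even q F <- {q} qmod hQ|lam_odd r r0 q F <- {q} qmod hQ].
(* In the even case TL is the whole of Z_d, and S is {0}. *)
- have q1 : (1 < #|F|)%N := card_finNzRing_gt1 F.
  set d := (k * t)%N in qmod hQ.
  have d1 : (1 < d)%N by rewrite (leq_trans hk) // leq_pmulr.
  have dq : (d %| #|F|.-1)%N by rewrite -subn1 -eqn_mod_dvd ?(ltnW q1) //; apply/eqP.
  have [cl [clM cl_onto _]] := discrete_log d1 dq.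
  pose TL := enum {: 'Z_d}.
  have cT x : count_mem x TL = 1%N by rewrite count_uniq_mem ?enum_uniq // mem_enum.
  apply: (SDF_to_FDF (TL := TL) (L0 := flatten (nseq lambda./2 TL)) (S := pred1 0)
    hk kdiv hSDF d1 clM cl_onto hQ).
  + by rewrite -cardE card_Zd.
  + move=> z; rewrite -(cT z); apply: eq_count => c /=.
    by rewrite subr_eq0 eq_sym.
  apply: count_mem_perm => x; rewrite count_cat count_map !count_nseq_flatten cT.
  rewrite (eq_count (a2 := pred1 (x - cl (-1)))) ?cT; last first.
    by move=> c /=; rewrite eq_sym -subr_eq eq_sym.
  by rewrite !muln1 addnn halfK (negbTE lam_even) subn0.
(* In the odd case -1 has logarithm d / 2 = e r, where k t = 2 e. *)
set d := (k * r * t)%N in qmod hQ.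
have d1 : (1 < d)%N by rewrite (leq_trans hk) // /d -mulnA leq_pmulr // muln_gt0 r0.
have q1 : (1 < #|F|)%N := card_finNzRing_gt1 F.
have [j qE] : exists j, (#|F|.-1 = d * j.*2.+1)%N.
  have := divn_eq #|F| (2 * d); rewrite qmod modn_small; last by lia.
  by exists (#|F| %/ (2 * d))%N; lia.
have dq : (d %| #|F|.-1)%N by rewrite qE dvdn_mulr.
have [Sf sdf] := hSDF.
have := SDF_even hk kdiv sdf; rewrite oddM lam_odd andbT => kt_even.
pose e := ((k * t)./2)%N.
have e2 : (2 * e = k * t)%N by rewrite mul2n halfK (negbTE kt_even) subn0.
have dE : d = (2 * (e * r))%N by rewrite mulnA e2 /d; lia.
have e0 : (0 < e)%N by rewrite -(@ltn_pmul2l 2) // muln0 e2 muln_gt0 ht (ltnW hk).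
have [cl [clM cl_onto cl_m1]] := discrete_log d1 dq.
have {}cl_m1 : cl (-1) = (e * r)%:R.
  have half_q : ((#|F|.-1)./2 = j * d + e * r)%N.
    rewrite qE {1}dE -mulnA mul2n doubleK -addnn dE; clear; ring.
  rewrite cl_m1; last by rewrite qE {1}dE -mulnA oddM.
  rewrite half_q -[LHS]Zp_nat_mod // modnMDl Zp_nat_mod //.
pose T0 : seq 'Z_d := [seq i%:R | i <- iota 0 e].
apply: (SDF_to_FDF (TL := T0 ++ [seq c + (e * r)%:R | c <- T0])
   (L0 := flatten (nseq lambda T0)) (S := @tile e r d) hk kdiv hSDF d1 clM cl_onto hQ).
- by rewrite size_cat !size_map size_iota -e2 mul2n addnn.
- by move=> z; rewrite -map_comp; exact: tiling_Zd.
apply: count_mem_perm => x; rewrite cl_m1 count_cat count_map !count_nseq_flatten.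
by rewrite count_cat mulnDr [in RHS](count_map (fun c => c + _)).
Qed.
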